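(* Let $\Bbbk$ be a field and let $\det_3 = \det\big((x_{i,j})_{1\le i,j\le 3}\big) \in \Bbbk[x_{1,1},\dotsc,x_{3,3}]$ be the generic $3\times 3$ determinant. Then the Waring rank of $\det_3$ satisfies $\operatorname{rk}(\det_3) \geq 15$.
   Context: For a homogeneous polynomial $F \in \Bbbk[x_1,\dotsc,x_n]$ of degree $d$, the Waring rank $\operatorname{rk}(F)$ is the least number $r$ of terms in an expression $F = c_1 \ell_1^d + \dotsb + c_r \ell_r^d$ with $c_i \in \Bbbk$ and $\ell_i$ linear forms (homogeneous of degree 1) in $\Bbbk[x_1,\dotsc,x_n]$; $\operatorname{rk}(F) = \infty$ if no such expression exists. The polynomial $\det_3$ is regarded as a cubic form in the $9$ independent variables $x_{i,j}$. *)

(* Defs.v *)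
From mathcomp Require Export all_boot all_algebra.
From mathcomp Require Import boolp.
From mathcomp Require Export mpoly.

Set Implicit Arguments.
Unset Strict Implicit.
Unset Printing Implicit Defensive.

Import GRing.Theory.

Local Open Scope ring_scope.

Definition is_power_sum (k : fieldType) (n d : nat) (F : {mpoly k[n]})
    (r : nat) : Prop :=
  exists (c : 'I_r -> k) (l : 'I_r -> {mpoly k[n]}),
    (forall i, l i \is 1.-homog) /\ F = \sum_(i < r) c i *: l i ^+ d.

(* [option nat] stands for the naturals extended with infinity ([None]). The
   degree [d] is an argument because it is not determined by [F] when
   [F = 0]. *)
Definition waring_rank (k : fieldType) (n d : nat) (F : {mpoly k[n]}) :
    option nat :=
  match pselect (exists r, `[< is_power_sum d F r >]) with
  | left ex => Some (ex_minn ex)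
  | right _ => None
  end.

Definition leq_enat (m : nat) (e : option nat) : bool :=
  if e is Some r then (m <= r)%N else true.

(* The variable x_(i, j) is the one whose index is the row-major position of
   (i, j), given by [mxvec_index]. *)
Definition generic_matrix (k : fieldType) (n : nat) : 'M[{mpoly k[n * n]}]_n :=
  \matrix_(i < n, j < n) 'X_(mxvec_index i j).

Definition det3 (k : fieldType) : {mpoly k[3 * 3]} := \det (generic_matrix k 3).

Lemma waring_rank_SomeP (k : fieldType) (n d : nat) (F : {mpoly k[n]}) r :
  waring_rank d F = Some r <->
  is_power_sum d F r /\ (forall s, is_power_sum d F s -> (r <= s)%N).
Proof.
rewrite /waring_rank; case: pselect => [ex|nex]; last first.
  by split=> // -[Fr _]; case: nex; exists r; apply/asboolP.
case: ex_minnP => m /asboolP Fm mP; split=> [[<-]|[Fr rP]].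
  by split=> // s /asboolP; apply: mP.
by congr Some; apply/eqP; rewrite eqn_leq rP // andbT mP //; apply/asboolP.
Qed.

Lemma waring_rank_NoneP (k : fieldType) (n d : nat) (F : {mpoly k[n]}) :
  waring_rank d F = None <-> forall r, ~ is_power_sum d F r.
Proof.
rewrite /waring_rank; case: pselect => [ex|nex]; split=> //.
  by move=> nF; exfalso; case: ex => r /asboolP; apply: nF.
by move=> _ r Fr; apply: nex; exists r; apply/asboolP.
Qed.

Lemma det3_homog (k : fieldType) : det3 k \is 3.-homog.
Proof.
rewrite /det3 /determinant; apply: rpred_sum => s _.
rewrite mulr_sign; set p := \prod_(i < 3) _.
suff hp : p \is 3.-homog by case: ifP => _ //; rewrite rpredN.
rewrite /p !big_ord_recl big_ord0 mulr1.
have hX i j : generic_matrix k 3 i j \is 1.-homog.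
  by rewrite mxE dhomogX; apply/eqP; apply: mdeg1.
exact: (dhomogM (hX _ _) (dhomogM (hX _ _) (hX _ _))).
Qed.

(* Main.v *)
Require Import Defs.
From HB Require Import structures.
From mathcomp Require Import fraction ring zify.

(* Polarizing an expression of [det3] as a combination of [r] cubes of linear
   forms [l i] gives [D (X, Y, Z) = \sum_i c i * l i X * l i Y * l i Z], where
   [D] is the mixed determinant. The [y] in [k^r] with
   [\sum_i c i * y i * l i Z = 0] for all [Z] form a space [U] of dimension
   [r - 9], by nondegeneracy of [D]. If [B] has rank one and [X] lies in the
   5-dimensional space [T_B] of matrices with [D (B, X, _) = 0] (the tangent
   space at [B] to the matrices of rank at most 1), then [(l i B * l i X)_i] is
   in [U]. So if [r <= 14] and no [l i] vanishes at [B'], the products of [B']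
   with [T_B'] fill [U], and for every rank one [B] and every [X] in [T_B] there
   is a quotient [X'] in [T_B'] with [l i B * l i X = l i B' * l i X'] for all
   [i]. Then [D (X', Y, Z) = D (X, Y', Z)] for all [X], [Y] in [T_B]. For
   [B = E_11] and [B' = E_22] these linear equations force [E_12' = 0], hence
   [l i E_12 = 0] for all [i] as soon as no [l i] vanishes at [E_11], which
   contradicts nondegeneracy. Over [k(t)] a change of coordinates
   [X |-> P X Q] ensures that no nonzero [l i] vanishes at [E_11] or [E_22]. *)

Set Implicit Arguments.
Unset Strict Implicit.
Unset Printing Implicit Defensive.

Import GRing.Theory.

Local Open Scope ring_scope.

(* Indices are natural numbers counted from 0: the matrix [E_11] of the
   comment above is [E 0 0]. *)
Local Notation o := (@inord 2).
Local Notation E i j := (delta_mx (o i) (o j) : 'M_3).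

(** * The mixed determinant *)

Definition mixed_det (R : comNzRingType) (X Y Z : 'M[R]_3) : R :=
  \det (X + Y + Z) - \det (X + Y) - \det (X + Z) - \det (Y + Z)
  + \det X + \det Y + \det Z.

Lemma det_mx33 (R : comNzRingType) (X : 'M[R]_3) :
  \det X =
    X (o 0) (o 0) * (X (o 1) (o 1) * X (o 2) (o 2) - X (o 1) (o 2) * X (o 2) (o 1))
  - X (o 0) (o 1) * (X (o 1) (o 0) * X (o 2) (o 2) - X (o 1) (o 2) * X (o 2) (o 0))
  + X (o 0) (o 2) * (X (o 1) (o 0) * X (o 2) (o 1) - X (o 1) (o 1) * X (o 2) (o 0)).
Proof.
pose f i j := X (o i) (o j).
have -> : X = \matrix_(i, j) f i j.
  by apply/matrixP=> i j; rewrite mxE /f !inord_val.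
rewrite (expand_det_row _ ord0) !big_ord_recl big_ord0 /cofactor.
rewrite !(expand_det_row _ ord0) !big_ord_recl !big_ord0 /cofactor !det_mx11.
rewrite !mxE /= /bump /= !inordK //.
rewrite ?addn0 ?expr0 ?expr1 ?expr2 /=; ring.
Qed.

Definition mixed_minor (R : comNzRingType) (Y Z : 'M[R]_3)
    (i j k l : nat) : R :=
  Y (o i) (o k) * Z (o j) (o l) + Z (o i) (o k) * Y (o j) (o l)
  - Y (o i) (o l) * Z (o j) (o k) - Z (o i) (o l) * Y (o j) (o k).

Lemma mixed_detE (R : comNzRingType) (X Y Z : 'M[R]_3) :
  mixed_det X Y Z =
    X (o 0) (o 0) * mixed_minor Y Z 1 2 1 2
  - X (o 0) (o 1) * mixed_minor Y Z 1 2 0 2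
  + X (o 0) (o 2) * mixed_minor Y Z 1 2 0 1
  - X (o 1) (o 0) * mixed_minor Y Z 0 2 1 2
  + X (o 1) (o 1) * mixed_minor Y Z 0 2 0 2
  - X (o 1) (o 2) * mixed_minor Y Z 0 2 0 1
  + X (o 2) (o 0) * mixed_minor Y Z 0 1 1 2
  - X (o 2) (o 1) * mixed_minor Y Z 0 1 0 2
  + X (o 2) (o 2) * mixed_minor Y Z 0 1 0 1.
Proof. rewrite /mixed_det /mixed_minor !det_mx33 !mxE; ring. Qed.

Lemma inord3_eq (i j : nat) : (i < 3)%N -> (j < 3)%N -> (o i == o j) = (i == j).
Proof. by move=> i3 j3; rewrite -val_eqE /= !inordK. Qed.

Local Ltac compute_mixed_det :=
  rewrite mixed_detE /mixed_minor !mxE !inord3_eq //=; ring.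

(** Cyclic shifts of three indices are even permutations, so the complementary minor enters without
    a sign. *)
Lemma mixed_det_delta (R : comNzRingType) (X : 'M[R]_3) (i j : nat) :
  (i < 3)%N -> (j < 3)%N ->
  mixed_det X (E ((i + 1) %% 3) ((j + 1) %% 3))
              (E ((i + 2) %% 3) ((j + 2) %% 3)) = X (o i) (o j).
Proof. by case: i j => [|[|[|//]]] [|[|[|//]]] _ _; compute_mixed_det. Qed.

Lemma mixed_det_nondegenerate (R : comNzRingType) (X : 'M[R]_3) :
  (forall Y Z, mixed_det X Y Z = 0) -> X = 0.
Proof.
move=> X0; apply/matrixP=> i j.
by rewrite -[i]inord_val -[j]inord_val -mixed_det_delta // X0 mxE.
Qed.

(** * Decompositions and the tangent space *)

Definition is_decomposition (K : fieldType) (r : nat) (c : 'I_r -> K)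
    (l : 'I_r -> {scalar 'M[K]_3}) : Prop :=
  forall X Y Z, mixed_det X Y Z = \sum_i c i * l i X * l i Y * l i Z.

Lemma decomposition_injective (K : fieldType) (r : nat) (c : 'I_r -> K)
    (l : 'I_r -> {scalar 'M[K]_3}) (X : 'M[K]_3) :
  is_decomposition c l -> (forall i, c i * l i X = 0) -> X = 0.
Proof.
move=> cl X0; apply: mixed_det_nondegenerate => Y Z.
by rewrite cl big1 // => i _; rewrite X0 !mul0r.
Qed.

(* The tangent space at [E 1 1] to the variety of matrices of rank at most 1. *)
Definition tangent (K : fieldType) (w : 'rV[K]_5) : 'M[K]_3 :=
  w 0 (@inord 4 0) *: E 1 0 + w 0 (@inord 4 1) *: E 1 1
  + w 0 (@inord 4 2) *: E 1 2 + w 0 (@inord 4 3) *: E 0 1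
  + w 0 (@inord 4 4) *: E 2 1.

Lemma tangent_eq0 (K : fieldType) (w : 'rV[K]_5) :
  tangent w (o 1) (o 0) = 0 -> tangent w (o 1) (o 1) = 0 ->
  tangent w (o 1) (o 2) = 0 -> tangent w (o 0) (o 1) = 0 ->
  tangent w (o 2) (o 1) = 0 -> w = 0.
Proof.
rewrite !mxE !inord3_eq //= ?(mulr0, mulr1, addr0, add0r) => w0 w1 w2 w3 w4.
apply/rowP=> i; rewrite -[i]inord_val mxE.
by case: i => [[|[|[|[|[|//]]]]] i5].
Qed.

Lemma tangent_is_linear (K : fieldType) : linear (@tangent K).
Proof. by move=> a u v; apply/matrixP=> i j; rewrite /tangent !mxE; ring. Qed.

HB.instance Definition _ (K : fieldType) :=
  GRing.isLinear.Build K _ _ _ (@tangent K) (@tangent_is_linear K).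

(** Only the mixed minor on rows and columns 0 and 2 survives, and [tangent w] vanishes there. *)
Lemma mixed_det_tangent (K : fieldType) (w : 'rV[K]_5) (Z : 'M[K]_3) :
  mixed_det (E 1 1) (tangent w) Z = 0.
Proof.
have -> Y : mixed_det (E 1 1) Y Z = mixed_minor Y Z 0 2 0 2.
  by rewrite mixed_detE !mxE !inord3_eq //=; ring.
by rewrite /mixed_minor !mxE !inord3_eq //=; ring.
Qed.

Lemma tangent_quotient (K : fieldType) (r : nat) (c : 'I_r -> K)
    (l : 'I_r -> {scalar 'M[K]_3}) (y : 'I_r -> K) :
  is_decomposition c l -> (r <= 14)%N ->
  (forall i, l i (E 1 1) = 0 -> forall X, l i X = 0) ->
  (forall Z, \sum_i y i * (c i * l i Z) = 0) ->
  exists w, forall i, y i = l i (E 1 1) * l i (tangent w).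
Proof.
move=> cl r14 l11 y0.
(* The space [U] is [kermx C]; the rows of [N] span the products of [E 1 1] with its tangent
   space. *)
pose C := \matrix_(i < r, m < 3 * 3) (c i * l i (vec_mx (delta_mx 0 m))).
pose N := \matrix_(a < 5, i < r) (l i (E 1 1) * l i (tangent (delta_mx 0 a))).
have mulC (u : 'cV_(3 * 3)) i : (C *m u) i 0 = c i * l i (vec_mx u^T).
  rewrite mxE [u^T]row_sum_delta !linear_sum mulr_sumr.
  by apply: eq_bigr => m _; rewrite !mxE !linearZ /= -mulrA [l i _ * _]mulrC.
have mulN (w : 'rV_5) i : (w *m N) 0 i = l i (E 1 1) * l i (tangent w).
  rewrite mxE [w in RHS]row_sum_delta !linear_sum mulr_sumr.
  by apply: eq_bigr => m _; rewrite !mxE !linearZ /= mulrCA.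
have rankC : \rank C = (3 * 3)%N.
  apply/eqP; rewrite -mxrank_tr -[_ == _]/(row_free _) -kermx_eq0.
  apply/rowV0P => v /sub_kermxP vC.
  suff /(canRL vec_mxK) -> : vec_mx v = 0 :> 'M_3 by rewrite linear0.
  apply: (decomposition_injective cl) => i.
  by rewrite -[v]trmxK -mulC -[C]trmxK -trmx_mul vC !mxE.
have freeN : row_free N.
  rewrite -kermx_eq0; apply/rowV0P => w /sub_kermxP wN.
  suff w0 : tangent w = 0 by apply: tangent_eq0; rewrite w0 mxE.
  apply: (decomposition_injective cl) => i.
  have /eqP := mulN w i; rewrite wN mxE eq_sym mulf_eq0.
  by move=> /orP[/eqP/l11 -> | /eqP ->]; rewrite mulr0.
have perpC (z : 'I_r -> K) :
    (forall Z, \sum_i z i * (c i * l i Z) = 0) -> (\row_i z i <= kermx C)%MS.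
  move=> z0; apply/sub_kermxP/rowP => m.
  rewrite !mxE -[RHS](z0 (vec_mx (delta_mx 0 m))).
  by apply: eq_bigr => i _; rewrite !mxE.
have NC : (N <= kermx C)%MS.
  apply/row_subP => a.
  have -> : row a N = \row_i (l i (E 1 1) * l i (tangent (delta_mx 0 a))).
    by apply/rowP=> i; rewrite !mxE.
  apply: perpC => Z; rewrite -[RHS](mixed_det_tangent (delta_mx 0 a) Z) cl.
  by apply: eq_bigr => i _; ring.
(* Dimension count: [kermx C] has rank [r - 9], which is at most 5, the rank of [N]. *)
have CN : (kermx C <= N)%MS.
  rewrite -(geq_leqif (mxrank_leqif_sup NC)) mxrank_ker rankC (eqP freeN).
  by rewrite leq_subLR.
have /submxP[w yN] := submx_trans (perpC y y0) CN.
by exists w => i; rewrite -mulN -yN mxE.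
Qed.

Lemma no_short_decomposition (K : fieldType) (r : nat) (c : 'I_r -> K)
    (l : 'I_r -> {scalar 'M[K]_3}) :
  is_decomposition c l ->
  (forall i, l i (E 0 0) = 0 -> forall X, l i X = 0) ->
  (forall i, l i (E 1 1) = 0 -> forall X, l i X = 0) ->
  (14 < r)%N.
Proof.
move=> cl l00 l11; rewrite ltnNge; apply/negP => r14.
pose is_quotient X w :=
  forall i, l i (E 0 0) * l i X = l i (E 1 1) * l i (tangent w).
have quotient X :
    (forall Z, mixed_det (E 0 0) X Z = 0) -> exists w, is_quotient X w.
  move=> X0; apply: (tangent_quotient cl r14 l11) => Z; rewrite -[RHS](X0 Z) cl.
  by apply: eq_bigr => i _; ring.
have [p pE] : exists w, is_quotient (E 0 0) w.
  by apply: quotient => Z; compute_mixed_det.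
have [q qE] : exists w, is_quotient (E 0 1) w.
  by apply: quotient => Z; compute_mixed_det.
have [s sE] : exists w, is_quotient (E 0 2) w.
  by apply: quotient => Z; compute_mixed_det.
have [t tE] : exists w, is_quotient (E 2 0) w.
  by apply: quotient => Z; compute_mixed_det.
(* Multiplied by [l i (E 1 1)], the [i]-th terms of both sides become
   [l i (E 0 0) * l i (E 0 1) * l i Y] times [c i * l i Z]; where [l i (E 1 1)] is zero, so is
   [l i]. *)
have exch Y w Z : is_quotient Y w ->
    mixed_det (tangent q) Y Z = mixed_det (tangent w) (E 0 1) Z.
  move=> wE; rewrite !cl; apply: eq_bigr => i _.
  rewrite -[c i * _ * _]mulrA -[c i * _ * _ in RHS]mulrA.
  congr (c i * _ * _).
  have [l0|l0] := eqVneq (l i (E 1 1)) 0; first by rewrite !(l11 i l0) !mulr0.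
  by apply: (mulfI l0); rewrite mulrA -qE [RHS]mulrA -wE; ring.
have tangent20 w : tangent w (o 2) (o 0) = 0.
  by rewrite !mxE !inord3_eq //= !mulr0 !addr0.
(* Each pair of test matrices isolates, up to sign, one of the five coordinates of [tangent q]; the
   other side is zero or the entry (2, 0), where [tangent] vanishes. *)
have q0 : q = 0.
  apply: tangent_eq0.
  - have := exch _ _ (E 2 1) sE.
    have -> X : mixed_det X (E 0 2) (E 2 1) = X (o 1) (o 0).
      by compute_mixed_det.
    by have -> X : mixed_det X (E 0 1) (E 2 1) = 0 by compute_mixed_det.
  - have := exch _ _ (E 0 2) tE.
    have -> X : mixed_det X (E 2 0) (E 0 2) = - X (o 1) (o 1).
      by compute_mixed_det.
    have -> X : mixed_det X (E 0 1) (E 0 2) = 0 by compute_mixed_det.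
    by move/eqP; rewrite oppr_eq0 => /eqP.
  - have := exch _ _ (E 2 1) pE.
    have -> X : mixed_det X (E 0 0) (E 2 1) = - X (o 1) (o 2).
      by compute_mixed_det.
    have -> X : mixed_det X (E 0 1) (E 2 1) = 0 by compute_mixed_det.
    by move/eqP; rewrite oppr_eq0 => /eqP.
  - have := exch _ _ (E 1 2) tE.
    have -> X : mixed_det X (E 2 0) (E 1 2) = X (o 0) (o 1).
      by compute_mixed_det.
    have -> X : mixed_det X (E 0 1) (E 1 2) = X (o 2) (o 0).
      by compute_mixed_det.
    by rewrite tangent20.
  - have := exch _ _ (E 1 2) pE.
    have -> X : mixed_det X (E 0 0) (E 1 2) = - X (o 2) (o 1).
      by compute_mixed_det.
    have -> X : mixed_det X (E 0 1) (E 1 2) = X (o 2) (o 0).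
      by compute_mixed_det.
    by rewrite tangent20; move/eqP; rewrite oppr_eq0 => /eqP.
have /matrixP/(_ (o 0) (o 1)) : E 0 1 = 0 :> 'M[K]_3.
  apply: (decomposition_injective cl) => i.
  have /eqP := qE i; rewrite q0 !linear0 mulr0 mulf_eq0.
  by move=> /orP[/eqP/l00 -> | /eqP ->]; rewrite mulr0.
by rewrite !mxE !eqxx => /eqP; rewrite oner_eq0.
Qed.

(** * From power sums to trace forms *)

Lemma dhomog1_sum (R : comNzRingType) (n : nat) (p : {mpoly R[n]}) :
  p \is 1.-homog -> p = \sum_i p@_U_(i) *: 'X_i.
Proof.
move=> p1; apply/mpolyP => m; rewrite raddf_sum /=.
under eq_bigr => i _ do rewrite mcoeffZ mcoeffX.
have [/mdeg1P[j /eqP ->]|m1] := boolP (mdeg m == 1%N).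
  rewrite (bigD1 j) //= eqxx mulr1 big1 ?addr0 // => i /negPf ij.
  suff -> : (U_(i)%MM == U_(j)%MM :> 'X_{1..n}) = false by rewrite mulr0.
  by apply/eqP=> /mnmP/(_ i); rewrite !mnm1E eqxx eq_sym ij.
rewrite (dhomog_nemf_coeff p1) // big1 // => i _.
by have [im|_] := eqVneq; [rewrite -im mdeg1 in m1 | rewrite mulr0].
Qed.

Lemma mmap_dhomog1 (k K : comNzRingType) (f : {rmorphism k -> K})
    (n : nat) (h : 'I_n -> K) (p : {mpoly k[n]}) :
  p \is 1.-homog -> mmap f h p = \sum_i f p@_U_(i) * h i.
Proof.
move=> /dhomog1_sum pE; rewrite [in LHS]pE raddf_sum.
by apply: eq_bigr => i _; rewrite /= mmapZ mmapX mmap1U.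
Qed.

Lemma mmap_generic_det (k K : fieldType) (f : {rmorphism k -> K})
    (n : nat) (X : 'M[K]_n) :
  mmap f (mxvec X 0) (\det (generic_matrix k n)) = \det X.
Proof.
rewrite -det_map_mx; congr (\det _); apply/matrixP=> i j.
by rewrite !mxE /= mmapX mmap1U mxvecE.
Qed.

(* Transposed, so that the form is [X |-> \tr (form_mx f p *m X)]. *)
Definition form_mx (k K : nzRingType) (f : k -> K) (n : nat)
    (p : {mpoly k[n * n]}) : 'M[K]_n :=
  \matrix_(i, j) f p@_U_(mxvec_index j i).

Lemma mmap_mxvec_dhomog1 (k K : fieldType) (f : {rmorphism k -> K})
    (n : nat) (X : 'M[K]_n) (p : {mpoly k[n * n]}) :
  p \is 1.-homog -> mmap f (mxvec X 0) p = \tr (form_mx f p *m X).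
Proof.
move=> /mmap_dhomog1 ->.
transitivity (\sum_j \sum_i f p@_U_(mxvec_index j i) * X j i).
  rewrite (reindex _ (curry_mxvec_bij _ _)) pair_bigA /=.
  by apply: eq_bigr => -[j i] _; rewrite /= mxvecE.
rewrite exchange_big; apply: eq_bigr => i _; rewrite mxE.
by apply: eq_bigr => j _; rewrite mxE.
Qed.

(* In characteristic 2 or 3 the right-hand side vanishes, which contradicts
   nondegeneracy, so these characteristics need no separate treatment. *)
Lemma mixed_det_cubes (K : fieldType) (r : nat) (c : 'I_r -> K)
    (L : 'I_r -> 'M[K]_3) :
  (forall X, \det X = \sum_i c i * \tr (L i *m X) ^+ 3) ->
  forall X Y Z, mixed_det X Y Z =
    \sum_i 6%:R * c i * \tr (L i *m X) * \tr (L i *m Y) * \tr (L i *m Z).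
Proof.
move=> detE X Y Z; rewrite /mixed_det !detE -!sumrB -!big_split /=.
by apply: eq_bigr => i _; rewrite !mulmxDr !mxtraceD; ring.
Qed.

(** * Change to generic coordinates over [k(t)] *)

Lemma mixed_det_mulmx (R : comNzRingType) (P Q X Y Z : 'M[R]_3) :
  mixed_det (P *m X *m Q) (P *m Y *m Q) (P *m Z *m Q)
  = \det P * \det Q * mixed_det X Y Z.
Proof.
by rewrite /mixed_det -!mulmxDl -!mulmxDr !det_mulmx; ring.
Qed.

(* With [u] the first (resp. second) column of [generic_basis t] and [v] that
   of [generic_basis (t ^+ 3)], the entries of [u *m v^T] are distinct powers
   of [t], so no nonzero linear form over [k] vanishes at [u *m v^T]. *)
Definition generic_basis (R : nzRingType) (t : R) : 'M[R]_3 :=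
  \matrix_(i, j) nth 0 [:: t ^+ i; t ^+ (2 - i); (i == o 1)%:R] j.

Lemma det_generic_basis (R : comNzRingType) (t : R) :
  \det (generic_basis t) = t ^+ 4 - 1.
Proof.
rewrite det_mx33 !mxE !inordK //= !inord3_eq //=; ring.
Qed.

Lemma mxtrace_mul_delta (R : comNzRingType) (n : nat) (M : 'M[R]_n)
    (i j : 'I_n) :
  \tr (M *m delta_mx i j) = M j i.
Proof.
rewrite -(mul_delta_mx (0 : 'I_1)) mulmxA mxtrace_mulC -rowE -colE.
by rewrite -[\tr _]/(\sum_i _) big_ord1 !mxE.
Qed.

Lemma no_short_cubes (K : fieldType) (r : nat) (c : 'I_r -> K)
    (L : 'I_r -> 'M[K]_3) (P Q : 'M[K]_3) :
  (forall X, \det X = \sum_i c i * \tr (L i *m X) ^+ 3) ->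
  \det P != 0 -> \det Q != 0 ->
  (forall i, (Q *m L i *m P) (o 0) (o 0) = 0 -> L i = 0) ->
  (forall i, (Q *m L i *m P) (o 1) (o 1) = 0 -> L i = 0) ->
  (14 < r)%N.
Proof.
move=> detE P0 Q0 L00 L11.
pose l i : {scalar 'M[K]_3} := mxtrace \o mulmx (Q *m L i *m P).
have lE i X : l i X = \tr (L i *m (P *m X *m Q)).
  by rewrite /l /= -!mulmxA mxtrace_mulC !mulmxA.
(* The 6 comes from polarizing a cube, the denominator from [mixed_det_mulmx]. *)
pose d i := 6%:R * c i / (\det P * \det Q).
have dl : is_decomposition d l.
  move=> X Y Z; apply: (mulfI (mulf_neq0 P0 Q0)).
  rewrite -mixed_det_mulmx (mixed_det_cubes detE) mulr_sumr.
  by apply: eq_bigr => i _; rewrite !lE /d; field; rewrite P0 Q0.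
apply: (no_short_decomposition dl) => i li0 X; rewrite lE.
  by rewrite L00 ?mul0mx ?mxtrace0 // -mxtrace_mul_delta.
by rewrite L11 ?mul0mx ?mxtrace0 // -mxtrace_mul_delta.
Qed.

Definition const_frac (k : fieldType) : k -> {fraction {poly k}} :=
  @tofrac {poly k} \o polyC.
HB.instance Definition _ (k : fieldType) := GRing.RMorphism.on (@const_frac k).

Definition frac_var (k : fieldType) : {fraction {poly k}} := tofrac 'X.

Lemma monomials_free (k : fieldType) (I : finType) (e : I -> nat) (a : I -> k) :
  injective e -> \sum_i const_frac (a i) * frac_var k ^+ e i = 0 ->
  forall i, a i = 0.
Proof.
move=> e_inj.
have -> : \sum_i const_frac (a i) * frac_var k ^+ e i
          = tofrac (\sum_i a i *: 'X^(e i)).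
  rewrite raddf_sum; apply: eq_bigr => i _.
  by rewrite -mul_polyC /= tofracM tofracXn.
move/eqP; rewrite tofrac_eq0 => /eqP/polyP a0 i.
have := a0 (e i); rewrite coef_sum coef0 (bigD1 i) //= coefZ coefXn eqxx mulr1.
rewrite big1 ?addr0 // => j ji; rewrite coefZ coefXn.
by rewrite (inj_eq e_inj) eq_sym (negPf ji) mulr0.
Qed.

Lemma frac_varX_neq1 (k : fieldType) (n : nat) :
  (0 < n)%N -> frac_var k ^+ n - 1 != 0.
Proof.
move=> n0; rewrite /frac_var -tofracXn -tofrac1 -tofracB tofrac_eq0.
by rewrite monic_neq0 // monicXnsubC.
Qed.


(** The diagonal entry is a combination of distinct powers of [t] with the coefficients of [p],
    which lie in [k]; as [t] is transcendental, they all vanish. *)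
Lemma form_mx_eq0 (k : fieldType) (K := {fraction {poly k}})
    (p : {mpoly k[3 * 3]}) (P Q : 'M[K]_3) (s : 'I_3) (e : 'I_3 * 'I_3 -> nat) :
  p \is 1.-homog -> injective e ->
  (forall i j, Q s i * P j s = frac_var k ^+ e (i, j)) ->
  (Q *m form_mx (@const_frac k) p *m P) s s = 0 ->
  form_mx (@const_frac k) p = 0.
Proof.
move=> p1 e_inj QP; rewrite mxE => sum0; apply/matrixP=> i j; rewrite !mxE.
suff a0 : forall ij : 'I_3 * 'I_3, p@_U_(mxvec_index ij.2 ij.1) = 0.
  by rewrite (a0 (i, j)) rmorph0.
apply: (monomials_free e_inj); rewrite -[RHS]sum0.
transitivity (\sum_i \sum_j
    const_frac p@_U_(mxvec_index j i) * frac_var k ^+ e (i, j)).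
  by rewrite pair_bigA; apply: eq_bigr => -[].
rewrite exchange_big; apply: eq_bigr => j' _; rewrite mxE mulr_suml.
by apply: eq_bigr => i' _; rewrite mxE -QP mulrCA mulrA.
Qed.

Theorem theorem17 (k : fieldType) : leq_enat 15 (waring_rank 3 (det3 k)).
Proof.
case rE: waring_rank => [r|//] /=.
have [[c [p [p1 detE]]] _] := (waring_rank_SomeP _ _ _).1 rE.
pose f : {rmorphism k -> {fraction {poly k}}} := @const_frac k.
pose L i := form_mx f (p i).
have detK X : \det X = \sum_i f (c i) * \tr (L i *m X) ^+ 3.
  rewrite -(mmap_generic_det f) -/(det3 k) detE raddf_sum.
  apply: eq_bigr => i _; rewrite /= mmapZ rmorphXn /=.
  by rewrite mmap_mxvec_dhomog1.
pose t := frac_var k.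
apply: (no_short_cubes detK (P := generic_basis t)
                            (Q := (generic_basis (t ^+ 3))^T)).
- by rewrite det_generic_basis frac_varX_neq1.
- by rewrite det_tr det_generic_basis -exprM frac_varX_neq1.
(* The first columns contribute [t ^+ (3 * i)] and [t ^+ j], so [i] and [j] are the base 3 digits of
   the exponent. *)
- pose e (ij : 'I_3 * 'I_3) := (3 * ij.1 + ij.2)%N.
  move=> i; apply: (form_mx_eq0 (p1 i) (e := e)).
    move=> [a b] [a' b']; rewrite /e /= => ab.
    have [b3 b3'] := (ltn_ord b, ltn_ord b').
    by congr pair; apply: val_inj => /=; lia.
  by move=> a b; rewrite !mxE inordK //= -exprM -exprD.
(* In the second columns each digit [d] is replaced by [2 - d]. *)
pose e (ij : 'I_3 * 'I_3) := (3 * (2 - ij.1) + (2 - ij.2))%N.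
move=> i; apply: (form_mx_eq0 (p1 i) (e := e)).
  move=> [a b] [a' b']; rewrite /e /= => ab.
  have [a3 a3'] := (ltn_ord a, ltn_ord a').
  have [b3 b3'] := (ltn_ord b, ltn_ord b').
  by congr pair; apply: val_inj => /=; lia.
by move=> a b; rewrite !mxE inordK //= -exprM -exprD.
Qed.
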